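(* Let $\mathcal{E}$ be a finite-dimensional Euclidean space, let $S\subseteq\mathcal{E}$ be a closed convex set with $0\in\mathrm{int}\,S$, and let $y\in\mathcal{E}$ with $\gamma_S(y)\neq0$. If $\frac12\gamma_S^2$ is (locally) $\mu$-strongly convex w.r.t. $(y,g)$, where $g\in\partial(\frac12\gamma_S^2)(y)$ and $\mu\in(0,\infty)$, then the set $S$ is (locally) strongly convex with parameter $\mu\,\zeta^T\bar y$ w.r.t. $(\bar y,\zeta)$, where $\bar y=y/\gamma_S(y)$ and $\zeta=g/\|g\|$.
   Context: $\|\cdot\|$ is the Euclidean norm and $B(x,r)$ the closed ball of center $x$ and radius $r$. The gauge of $S$ is $\gamma_S(x)=\inf\{\lambda>0\mid x\in\lambda S\}$. The normal cone at $x\in S$ is $N_S(x)=\{\zeta\mid \zeta^T(z-x)\le 0\ \forall z\in S\}$; $\partial h(x)=\{g\mid h(z)-h(x)\ge g^T(z-x)\ \forall z\}$. Local strong convexity of a set: for $\bar y\in \mathrm{bdry}\,S$ and unit $\zeta\in N_S(\bar y)$, $S$ is (locally) $\alpha$-strongly convex w.r.t. $(\bar y,\zeta)$ if for every $0<\tilde\alpha<\alpha$ there is $\eta>0$ small enough that $S\cap B(\bar y,\eta)\subseteq B(\bar y-\frac1{\tilde\alpha}\zeta,\frac1{\tilde\alpha})\cap B(\bar y,\eta)$. Local strong convexity of a function: a closed convex function $h$ is (locally) $\mu$-strongly convex w.r.t. $(x,g)$, $g\in\partial h(x)$, if for every $\tilde\mu<\mu$ there is $\eta>0$ with $h(z)\ge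 h(x)+g^T(z-x)+\frac{\tilde\mu}{2}\|z-x\|^2$ for all $z\in B(x,\eta)$. *)

(* Defs.v *)
From HB Require Import structures.
From mathcomp Require Import all_boot all_order all_algebra.
From mathcomp Require Import all_classical all_reals all_analysis.
Import Order.TTheory GRing.Theory Num.Theory.
Import numFieldNormedType.Exports.

Set Implicit Arguments.
Unset Strict Implicit.
Unset Printing Implicit Defensive.

Local Open Scope classical_set_scope.
Local Open Scope ring_scope.

#[short(type="normedVectType")]
HB.structure Definition NormedVector (R : numFieldType) :=
  {E of Vector R E & NormedModule R E}.

(* A finite-dimensional real inner product space: the norm, hence also the
   topology, is the one induced by the inner product. *)
HB.mixin Record NormedVector_isEuclidean (R : realType) E
    of NormedVector R E := {
  inner : {dot E for (@idfun R)};
  innerxx : forall x : E, inner x x = `|x| ^+ 2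
}.

#[short(type="euclideanType")]
HB.structure Definition Euclidean (R : realType) :=
  {E of NormedVector R E & NormedVector_isEuclidean R E}.

Notation "''[' x , y ]" := (inner x y) : ring_scope.

Section Definitions.
Context {R : realType} {E : euclideanType R}.
Implicit Types (S : set E) (h : E -> R) (x y z g zeta : E).

Definition cball x (r : R) : set E := closed_ball_ Num.norm x r.

Definition boundary S : set E := closure S `\` S°.

(* [inf] is real-valued, with junk value 0 on the empty set; it is the true
   infimum at every point when 0 is interior to S. *)
Definition gauge_fun S x : R :=
  inf [set l : R | 0 < l /\ [set l *: z | z in S] x].

Definition half_sq_gauge S x : R := 2^-1 * gauge_fun S x ^+ 2.

Definition normal_cone S x : set E :=
  [set zeta | forall z, S z -> '[zeta, z - x] <= 0].

Definition subdifferential h x : set E :=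
  [set g | forall z, '[g, z - x] <= h z - h x].

Definition loc_strongly_convex_fun (mu : R) h x g : Prop :=
  forall mu' : R, mu' < mu ->
  exists2 eta : R, 0 < eta &
    forall z, cball x eta z ->
      h x + '[g, z - x] + mu' / 2 * `|z - x| ^+ 2 <= h z.

(* The first three conjuncts say that (y, zeta) is an admissible pair. *)
Definition loc_strongly_convex_set (alpha : R) S y zeta : Prop :=
  [/\ boundary S y, normal_cone S y zeta, `|zeta| = 1 &
   forall alpha' : R, 0 < alpha' < alpha ->
   exists2 eta : R, 0 < eta &
     S `&` cball y eta `<=`
       cball (y - alpha'^-1 *: zeta) alpha'^-1 `&` cball y eta].

End Definitions.

(* Main.v *)
(** Write [G] for the gauge of [y]. Testing the subgradient inequality along the
    ray through [y] gives Euler's identity [<g, y> = G^2], so [<zeta, ybar> =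
    G / |g|]. For [z] in [S] the point [G z] has gauge at most [G], hence strong
    convexity at [y] yields
    [<g, G (z - ybar)> + mu' / 2 * G^2 * |z - ybar|^2 <= 0].
    Dividing by [G |g|] and completing the square, this is the membership of [z]
    in the ball of radius [1 / alpha'] with [alpha' = mu' <zeta, ybar>]. *)
Require Import Defs.
From HB Require Import structures.
From mathcomp Require Import all_boot all_order all_algebra.
From mathcomp Require Import all_classical all_reals all_analysis.
From mathcomp Require Import ring lra.
Import Order.TTheory GRing.Theory Num.Theory.
Import numFieldNormedType.Exports.

Local Open Scope classical_set_scope.
Local Open Scope ring_scope.

Section Inner.
Context {R : realType} {E : euclideanType R}.
Implicit Types (x y z : E) (a : R).

Lemma innerC x y : '[x, y] = '[y, x].
Proof. by rewrite hermC expr0 mul1r. Qed.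

Lemma innerZl a x y : '[a *: x, y] = a * '[x, y].
Proof. by rewrite linearZl_LR. Qed.

Lemma innerZr a x y : '[x, a *: y] = a * '[x, y].
Proof. by rewrite innerC innerZl innerC. Qed.

Lemma normDsq x y : `|x + y| ^+ 2 = `|x| ^+ 2 + 2 * '[x, y] + `|y| ^+ 2.
Proof.
rewrite -!innerxx linearDl !linearDr /= (innerC y x); ring.
Qed.

End Inner.

Section Gauge.
Context {R : realType} {E : euclideanType R} (S : set E).
Implicit Types (x y z g : E) (l t : R).

Let scales x : set R := [set l : R | 0 < l /\ [set l *: z | z in S] x].

Let scales_lb x : has_lbound (scales x).
Proof. by exists 0 => l [/ltW]. Qed.

Let scalesZ t x l : 0 < t -> scales x l -> scales (t *: x) (t * l).
Proof.
move=> t0 [l0 [z Sz <-]]; split; first exact: mulr_gt0.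
by exists z; rewrite ?scalerA.
Qed.

Lemma gauge_ge0 x : 0 <= gauge_fun S x.
Proof.
rewrite /gauge_fun -/(scales x).
(* If no scale exists, [inf] takes its default value 0, which is also nonnegative. *)
have [[nS _]|/inf_out -> //] := pselect (has_inf (scales x)).
by apply: lb_le_inf => // l [/ltW].
Qed.

Lemma gauge_le l z : 0 < l -> S z -> gauge_fun S (l *: z) <= l.
Proof. by move=> l0 Sz; apply: (ge_inf (scales_lb _)); split => //; exists z. Qed.

(** Scaling by [t] maps the scales of [x] to scales of [t *: x], which gives one inequality; the
    same inequality for [t^-1] gives the other. *)
Lemma gaugeZ t x : 0 < t -> gauge_fun S (t *: x) = t * gauge_fun S x.
Proof.
have le u z : 0 < u -> gauge_fun S (u *: z) <= u * gauge_fun S z.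
  (* Without a scale for [z] there is none for [u *: z] either, and both infima default to 0. *)
  move=> u0; have [[l Al]|nA] := pselect (scales z !=set0); last first.
    rewrite /gauge_fun !inf_out ?mulr0 //; first by case=> /nA.
    move=> [[l Al] _]; apply: nA; exists (u^-1 * l).
    by have := @scalesZ u^-1 _ _ _ Al; rewrite scalerK ?gt_eqF//; apply; rewrite invr_gt0.
  rewrite -ler_pdivrMl//; apply: lb_le_inf; first by exists l.
  by move=> m Am; rewrite ler_pdivrMl//; apply: (ge_inf (scales_lb _)); exact: scalesZ.
move=> t0; apply/le_anti; rewrite le//= -ler_pdivlMl//.
by have := le t^-1 (t *: x); rewrite scalerK ?gt_eqF// invr_gt0; apply.
Qed.

(** Scales [l] close to 1 write [x] as [l *: z] with [z] in [S] close to [x], so [x] is in the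
    closure. *)
Lemma gauge_eq1_mem x : closed S -> gauge_fun S x = 1 -> S x.
Proof.
move=> /closure_id clS x1; rewrite clS => B /nbhs_ballP[e /= e0 xB].
have hinf : has_inf (scales x).
  apply: contrapT => /inf_out x0.
  by move: x1; rewrite /gauge_fun x0 => /eqP; rewrite eq_sym oner_eq0.
(* Since [l >= 1], the distance from [x] to [z] is [(l - 1) * |z| <= (l - 1) * |x|], which this
   bound on [l - 1] keeps below [e]. *)
have d0 : 0 < e / (1 + `|x|) by rewrite divr_gt0// ltr_wpDr.
have [l [l0 [z Sz zx]]] := inf_adherent d0 hinf.
rewrite -/(gauge_fun S x) x1 => le.
have l1 : 1 <= l by rewrite -x1 -zx; exact: gauge_le.
exists z; split => //; apply: xB; rewrite -ball_normE /= -zx.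
rewrite -{2}(scale1r z) -scalerBl normrZ ger0_norm ?subr_ge0//.
move: le; rewrite -ltrBlDl ltr_pdivlMr ?ltr_wpDr//; apply: le_lt_trans.
apply: ler_wpM2l; first by rewrite subr_ge0.
rewrite -zx normrZ ger0_norm ?(ltW l0)//.
have := ler_peMl (normr_ge0 z) l1; lra.
Qed.

(** A slightly stretched point [(1 + d) *: x] still lies in [S], so [1 + d] times the gauge of [x]
    is at most 1. *)
Lemma gauge_interior x : S° x -> gauge_fun S x < 1.
Proof.
move=> /nbhs_ballP[e /= e0 xS].
have d0 : 0 < e / (1 + `|x|) by rewrite divr_gt0// ltr_wpDr.
set d := e / _ in d0.
have t0 : 0 < 1 + d by lra.
have St : S ((1 + d) *: x).
  apply: xS; rewrite -ball_normE /= scalerDl scale1r opprD addNKr normrN normrZ.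
  rewrite gtr0_norm// /d mulrAC ltr_pdivrMr ?ltr_wpDr// ltr_pM2l//; lra.
have := @gauge_le 1 _ ltr01 St; rewrite scale1r gaugeZ// => h.
rewrite ltNge; apply/negP => x1.
have : 1 + d <= (1 + d) * gauge_fun S x by rewrite ler_peMr// ltW.
lra.
Qed.

Lemma half_sq_gaugeZ t x :
  0 < t -> half_sq_gauge S (t *: x) = t ^+ 2 * half_sq_gauge S x.
Proof. by move=> t0; rewrite /half_sq_gauge gaugeZ//; ring. Qed.

Lemma inner_subgradient_half_sq_gauge y g :
  subdifferential (half_sq_gauge S) y g -> '[g, y] = gauge_fun S y ^+ 2.
Proof.
move=> gy; set a := '[g, y]; set b := _ ^+ 2.
have b0 : 0 <= b by exact: sqr_ge0.
have ray t : 0 < t -> (t - 1) * a <= (t ^+ 2 - 1) * (b / 2).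
  move=> t0; have := gy (t *: y); rewrite half_sq_gaugeZ//.
  rewrite -{2}(scale1r y) -scalerBl innerZr -/a /half_sq_gauge -/b; lra.
apply/le_anti/andP; split; apply/ler_addgt0Pr => e e0.
(* Taking [t = 1 + s] and dividing by [s] leaves the error [s * b / 2], below [e] for this [s]. *)
- have d0 : 0 < e / (1 + b) by rewrite divr_gt0// ltr_wpDr.
  have dE : e / (1 + b) * (1 + b) = e by rewrite divfK// gt_eqF// ltr_wpDr.
  move: d0 dE; set s := e / _ => s0 sE.
  have h : s * a <= s * (b + s * b / 2) by have := ray (1 + s); lra.
  by move: h; rewrite ler_pM2l//; have := mulr_ge0 (ltW s0) b0; lra.
(* Now [t = 1 - s]; the extra [e] in the denominator ensures [s < 1], hence [t > 0]. *)
- have d0 : 0 < e / (1 + e + b) by rewrite divr_gt0//; lra.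
  have dE : e / (1 + e + b) * (1 + e + b) = e by rewrite divfK// gt_eqF//; lra.
  move: d0 dE; set s := e / _ => s0 sE.
  have s1 : s < 1 by rewrite /s ltr_pdivrMr; lra.
  have h : s * (b - s * b / 2) <= s * a by have := ray (1 - s); lra.
  move: h; rewrite ler_pM2l//.
  by have := mulr_ge0 (ltW s0) b0; have := mulr_gt0 s0 e0; lra.
Qed.

End Gauge.

Theorem theorem17 (R : realType) (E : euclideanType R) (S : set E)
    (S_closed : closed S) (S_convex : convex_set S)
    (S_int0 : S° 0)
    (y : E) (gauge_y : gauge_fun S y != 0)
    (g : E) (mu : R) (mu_gt0 : 0 < mu)
    (g_sub : subdifferential (half_sq_gauge S) y g)
    (h_sc : loc_strongly_convex_fun mu (half_sq_gauge S) y g) :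
  let ybar := (gauge_fun S y)^-1 *: y in
  let zeta := `|g|^-1 *: g in
  loc_strongly_convex_set (mu * '[zeta, ybar]) S ybar zeta.
Proof.
move=> ybar zeta; set G := gauge_fun S y in gauge_y *.
have G0 : 0 < G by rewrite lt_neqAle eq_sym gauge_y gauge_ge0.
have gy : '[g, y] = G ^+ 2 by exact: inner_subgradient_half_sq_gauge.
have yE : y = G *: ybar by rewrite /ybar scalerA divff// scale1r.
have g0 : 0 < `|g|.
  rewrite normr_gt0; apply/eqP => g0; move: gy; rewrite g0 linear0l => /esym/eqP.
  by rewrite expf_eq0 /= (negbTE gauge_y).
have ybar1 : gauge_fun S ybar = 1 by rewrite gaugeZ ?invr_gt0// mulVf.
have zetaE x : '[g, x] = `|g| * '[zeta, x].
  by rewrite /zeta innerZl mulrA divff ?gt_eqF// mul1r.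
have c0 : 0 < '[zeta, ybar].
  by rewrite /zeta /ybar innerZl innerZr gy !mulr_gt0// ?invr_gt0// exprn_gt0.
have gE : `|g| = G / '[zeta, ybar].
  apply/(canRL (mulfK _)); first by rewrite gt_eqF.
  by rewrite -zetaE /ybar innerZr gy expr2 mulKf.
have GzB z : G *: z - y = G *: (z - ybar) by rewrite [in LHS]yE -scalerBr.
have hle z : S z -> half_sq_gauge S (G *: z) <= half_sq_gauge S y.
  move=> Sz; rewrite /half_sq_gauge ler_pM2l ?invr_gt0// lerXn2r ?nnegrE ?gauge_ge0//.
  exact: gauge_le.
have zeta1 : `|zeta| = 1 by rewrite normrZ ger0_norm ?invr_ge0// mulVf// gt_eqF.
have Sybar : S ybar by exact: gauge_eq1_mem.
split => //.
- split; first exact: subset_closure.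
  by move=> /gauge_interior; rewrite ybar1 ltxx.
- move=> z Sz; have := g_sub (G *: z); have := hle z Sz.
  rewrite GzB innerZr zetaE => h1 h2.
  have : G * (`|g| * '[zeta, z - ybar]) <= 0 by lra.
  by rewrite !pmulr_rle0.
- move=> al /andP[al0 almu].
  have mu' : al / '[zeta, ybar] < mu by rewrite ltr_pdivrMr.
  have [eta eta0 H] := h_sc _ mu'.
  exists (eta / G); first exact: divr_gt0.
  move=> z [Sz zB]; split => //.
  have /H : cball y eta (G *: z).
    rewrite /cball /closed_ball_ /= distrC GzB normrZ gtr0_norm// mulrC.
    by rewrite -ler_pdivlMr// distrC.
  rewrite GzB innerZr zetaE normrZ gtr0_norm//.
  have := hle z Sz.
  set p := '[zeta, z - ybar]; set n := `|z - ybar| => h1 h2.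
  (* By [gE], the modulus [al / '[zeta, ybar]] times [G ^+ 2] equals [al * G * |g|], so [G * |g|]
     factors out. *)
  have h3 : G * `|g| * (p + al / 2 * n ^+ 2) <= 0.
    have -> : G * `|g| * (p + al / 2 * n ^+ 2) =
        G * (`|g| * p) + al / '[zeta, ybar] / 2 * (G * n) ^+ 2.
      by rewrite gE; field; rewrite gt_eqF.
    lra.
  rewrite pmulr_rle0 ?mulr_gt0// in h3.
  rewrite /cball /closed_ball_ /= distrC opprB addrA addrAC.
  (* After squaring, the term [al^-1 ^+ 2] cancels because [zeta] is a unit vector; what remains is
     a positive multiple of [h3]. *)
  rewrite -(@ler_pXn2r _ 2) ?nnegrE ?invr_ge0 ?(ltW al0)//.
  rewrite normDsq normrZ zeta1 mulr1 ger0_norm ?invr_ge0 ?(ltW al0)// innerZr.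
  rewrite innerC -/p -/n gerDr.
  have -> : n ^+ 2 + 2 * (al^-1 * p) = 2 / al * (p + al / 2 * n ^+ 2).
    by field; rewrite gt_eqF.
  by rewrite pmulr_rle0// divr_gt0.
Qed.
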